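(* Let $\mathcal{C}$ be a fusion category over a field $\Bbbk$ and let $\mathcal{D}$, $\mathcal{E}$ be two fusion subcategories of $\mathcal{C}$. Let $\mathcal{B}_1,\dots,\mathcal{B}_l$ be the $\mathcal{D}$-$\mathcal{E}$ double coset subcategories of $\mathcal{C}$. Then there is a decomposition of $\mathcal{C}$ as a sum of indecomposable $\mathcal{D}$-$\mathcal{E}$ bimodule categories $$\mathcal{C}=\bigoplus_{i=1}^{l}\mathcal{B}_i .$$
   Context: A fusion category over a field $\Bbbk$ is a $\Bbbk$-linear semisimple rigid monoidal category with finitely many isomorphism classes of simple objects, finite dimensional Hom spaces, such that $\mathrm{End}(S)=\Bbbk$ for every simple object $S$, and whose unit object $\mathbf{1}$ is simple. A fusion subcategory of $\mathcal{C}$ is a full replete monoidal subcategory which is itself a fusion category. $\Lambda_{\mathcal{C}}$ denotes the set of isomorphism classes of simple objects of $\mathcal{C}$. ''$Y$ is a factor of $Z$'' means that $Y$ is (isomorphic to) a direct summand of $Z$. Given fusion subcategories $\mathcal{D},\mathcal{E}$ of $\mathcal{C}$, define on $\Lambda_{\mathcal{C}}$ the relation: $X\sim Y$ iff there exist $D\in\Lambda_{\mathcal{D}}$ and $E\in\Lambda_{\mathcal{E}}$ such that $Y$ is a factor of $D\otimes X\otimes E$. This is an equivalence relation; its classes are called $\mathcal{D}$-$\mathcal{E}$ double cosets. If $B$ is a $\mathcal{D}$-$\mathcal{E}$ double coset, the corresponding double coset subcategory $\mathcal{B}\subset\mathcal{C}$ is the full subcategory whose objects are the finite direct sums of simple objects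 belonging to $B$. The category $\mathcal{C}$ is a $\mathcal{D}$-$\mathcal{E}$ bimodule category (i.e. a left module category over $\mathcal{D}\boxtimes\mathcal{E}^{\mathrm{rev}}$, where $\mathcal{E}^{\mathrm{rev}}$ is $\mathcal{E}$ with opposite monoidal structure), $\mathcal{D}$ acting by tensoring on the left and $\mathcal{E}$ by tensoring on the right. A (bi)module category (assumed $\Bbbk$-linear semisimple abelian with $\Bbbk$-bilinear action) is indecomposable if it is not a direct sum of two nontrivial sub-(bi)module categories. *)

(* Defs.v *)
From mathcomp Require Import all_boot all_algebra.
From mathcomp Require Import boolp classical_sets.

Set Implicit Arguments.
Unset Strict Implicit.
Unset Printing Implicit Defensive.

Import GRing.Theory.
Local Open Scope classical_set_scope.
Local Open Scope ring_scope.

Declare Scope lincat_scope.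
Delimit Scope lincat_scope with lincat.
Local Open Scope lincat_scope.

Record lincat (k : fieldType) : Type := LinCat {
  lc_ob :> Type;
  hom : lc_ob -> lc_ob -> lmodType k;
  idm : forall X, hom X X;
  compm : forall X Y Z, hom Y Z -> hom X Y -> hom X Z;
  compmA : forall X Y Z T (h : hom Z T) (g : hom Y Z) (f : hom X Y),
    compm h (compm g f) = compm (compm h g) f;
  comp1m : forall X Y (f : hom X Y), compm (idm Y) f = f;
  compm1 : forall X Y (f : hom X Y), compm f (idm X) = f;
  compm_linl : forall X Y Z (a : k) (g g' : hom Y Z) (f : hom X Y),
    compm (a *: g + g') f = a *: compm g f + compm g' f;
  compm_linr : forall X Y Z (a : k) (g : hom Y Z) (f f' : hom X Y),
    compm g (a *: f + f') = a *: compm g f + compm g f' }.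

Arguments hom {k C} X Y : rename.
Arguments idm {k C} X : rename.
Arguments compm {k C X Y Z} g f : rename.

Notation "X ~> Y" := (hom X Y) (at level 70, no associativity) : lincat_scope.
Notation "g ∘ f" := (compm g f) (at level 40, left associativity) : lincat_scope.

Section Lincat.
Context {k : fieldType} {C : lincat k}.
Implicit Types X Y Z K : C.

Definition inverse X Y (f : X ~> Y) (g : Y ~> X) : Prop :=
  g ∘ f = idm X /\ f ∘ g = idm Y.
Definition is_iso X Y (f : X ~> Y) : Prop := exists g, inverse f g.
Definition isomorphic X Y : Prop := exists f : X ~> Y, is_iso f.

Definition mono X Y (f : X ~> Y) : Prop :=
  forall Z (g g' : Z ~> X), f ∘ g = f ∘ g' -> g = g'.
Definition epi X Y (f : X ~> Y) : Prop :=
  forall Z (g g' : Y ~> Z), g ∘ f = g' ∘ f -> g = g'.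

Definition zero_object X : Prop :=
  forall Y, (forall f : X ~> Y, f = 0) /\ (forall f : Y ~> X, f = 0).

(** [X] is a biproduct of the finite family [Y]; for an empty family this says
    that [X] is a zero object. *)
Definition is_direct_sum (I : finType) (Y : I -> C) X : Prop :=
  exists (inj : forall i, Y i ~> X) (proj : forall i, X ~> Y i),
    [/\ forall i, proj i ∘ inj i = idm (Y i),
        forall i j, i != j -> proj i ∘ inj j = 0
      & \sum_i (inj i ∘ proj i) = idm X].

(** [Y] is isomorphic to a direct summand of [Z]. *)
Definition factor Y Z : Prop :=
  exists Y', is_direct_sum (fun b : bool => if b then Y else Y') Z.

Definition is_kernel K X Y (i : K ~> X) (f : X ~> Y) : Prop :=
  f ∘ i = 0 /\
  forall Z (g : Z ~> X), f ∘ g = 0 -> exists! h : Z ~> K, i ∘ h = g.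
Definition is_cokernel X Y K (p : Y ~> K) (f : X ~> Y) : Prop :=
  p ∘ f = 0 /\
  forall Z (g : Y ~> Z), g ∘ f = 0 -> exists! h : K ~> Z, h ∘ p = g.

Definition simple X : Prop :=
  ~ zero_object X /\
  forall Y (f : Y ~> X), mono f -> zero_object Y \/ is_iso f.

Definition iso_class X : set C := [set Y | isomorphic X Y].
End Lincat.

Section Abelian.
Context {k : fieldType} (C : lincat k).

Record abelian : Prop := Abelian {
  ab_sum : forall n (Y : 'I_n -> C), exists X, is_direct_sum Y X;
  ab_ker : forall (X Y : C) (f : X ~> Y), exists K (i : K ~> X), is_kernel i f;
  ab_coker : forall (X Y : C) (f : X ~> Y), exists K (p : Y ~> K), is_cokernel p f;
  ab_mono : forall (K X : C) (i : K ~> X), mono i ->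
    exists Y (f : X ~> Y), is_kernel i f;
  ab_epi : forall (Y K : C) (p : Y ~> K), epi p ->
    exists X (f : X ~> Y), is_cokernel p f }.

Definition semisimple : Prop :=
  abelian /\
  forall X : C, exists n (S : 'I_n -> C),
    (forall i, simple (S i)) /\ is_direct_sum S X.

(** The set of isomorphism classes of simple objects, an isomorphism class
    being the set of its members. *)
Definition Lambda : Type :=
  {c : set C | exists X : C, simple X /\ c = iso_class X}.
End Abelian.

Record bifunctor (k : fieldType) (A B C : lincat k) : Type := Bifunctor {
  bf_ob :> A -> B -> C;
  bf_hom : forall X X' Y Y', X ~> X' -> Y ~> Y' -> bf_ob X Y ~> bf_ob X' Y';
  bf_id : forall X Y, bf_hom (idm X) (idm Y) = idm (bf_ob X Y);
  bf_comp : forall X X' X'' Y Y' Y'' (f' : X' ~> X'') (f : X ~> X')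
      (g' : Y' ~> Y'') (g : Y ~> Y'),
    bf_hom (f' ∘ f) (g' ∘ g) = bf_hom f' g' ∘ bf_hom f g;
  bf_linl : forall X X' Y Y' (a : k) (f f' : X ~> X') (g : Y ~> Y'),
    bf_hom (a *: f + f') g = a *: bf_hom f g + bf_hom f' g;
  bf_linr : forall X X' Y Y' (a : k) (f : X ~> X') (g g' : Y ~> Y'),
    bf_hom f (a *: g + g') = a *: bf_hom f g + bf_hom f g' }.

Arguments bf_hom {k A B C} F {X X' Y Y'} f g : rename.

Record moncat (k : fieldType) : Type := MonCat {
  mc_cat :> lincat k;
  unit : mc_cat;
  tens : bifunctor mc_cat mc_cat mc_cat;
  assoc : forall X Y Z, tens (tens X Y) Z ~> tens X (tens Y Z);
  associ : forall X Y Z, tens X (tens Y Z) ~> tens (tens X Y) Z;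
  lunit : forall X, tens unit X ~> X;
  runit : forall X, tens X unit ~> X;
  assocK : forall X Y Z, inverse (assoc X Y Z) (associ X Y Z);
  lunit_iso : forall X, is_iso (lunit X);
  runit_iso : forall X, is_iso (runit X);
  assoc_nat : forall X X' Y Y' Z Z' (f : X ~> X') (g : Y ~> Y') (h : Z ~> Z'),
    assoc X' Y' Z' ∘ bf_hom tens (bf_hom tens f g) h =
    bf_hom tens f (bf_hom tens g h) ∘ assoc X Y Z;
  lunit_nat : forall X X' (f : X ~> X'),
    lunit X' ∘ bf_hom tens (idm unit) f = f ∘ lunit X;
  runit_nat : forall X X' (f : X ~> X'),
    runit X' ∘ bf_hom tens f (idm unit) = f ∘ runit X;
  pentagon : forall W X Y Z,
    bf_hom tens (idm W) (assoc X Y Z) ∘ assoc W (tens X Y) Z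
      ∘ bf_hom tens (assoc W X Y) (idm Z) =
    assoc W X (tens Y Z) ∘ assoc (tens W X) Y Z;
  triangle : forall X Y,
    bf_hom tens (idm X) (lunit Y) ∘ assoc X unit Y =
    bf_hom tens (runit X) (idm Y) }.

Arguments unit {k C} : rename.
Arguments tens {k C} : rename.
Arguments assoc {k C} X Y Z : rename.
Arguments associ {k C} X Y Z : rename.
Arguments lunit {k C} X : rename.
Arguments runit {k C} X : rename.

Notation "X ⊗ Y" := (bf_ob tens X Y)
  (at level 40, left associativity) : lincat_scope.
Notation "f ⊗ₘ g" := (bf_hom tens f g)
  (at level 39, left associativity) : lincat_scope.

Section Fusion.
Context {k : fieldType} (C : moncat k).

(** [Y] is a left dual of [X]; the two snake identities are written with the
    unit isomorphisms moved to the right-hand side. *)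
Definition left_dual (X Y : C) : Prop :=
  exists (ev : Y ⊗ X ~> unit) (coev : unit ~> X ⊗ Y),
    runit X ∘ (idm X ⊗ₘ ev) ∘ assoc X Y X ∘ (coev ⊗ₘ idm X) = lunit X /\
    lunit Y ∘ (ev ⊗ₘ idm Y) ∘ associ Y X Y ∘ (idm Y ⊗ₘ coev) = runit Y.

Record is_fusion : Prop := IsFusion {
  fus_semisimple : semisimple C;
  fus_left_dual : forall X : C, exists Y, left_dual X Y;
  fus_right_dual : forall X : C, exists Y, left_dual Y X;
  fus_finite : exists n (S : 'I_n -> C),
    forall X : C, simple X -> exists i, isomorphic X (S i);
  fus_hom : forall X Y : C, exists n (e : 'I_n -> (X ~> Y)),
    forall f, exists c : 'I_n -> k, f = \sum_i c i *: e i;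
  fus_end : forall S : C, simple S ->
    forall f : S ~> S, exists! c : k, f = c *: idm S;
  fus_unit : simple (unit : C) }.
End Fusion.

Record fusion_cat (k : fieldType) : Type := FusionCat {
  fus_cat :> moncat k;
  fusP : is_fusion fus_cat }.

Definition full_subcat (k : fieldType) (C : lincat k) (P : set C) : lincat k :=
  @LinCat k {X : C | P X} (fun X Y => sval X ~> sval Y)
    (fun X => idm (sval X)) (fun X Y Z g f => g ∘ f)
    (fun X Y Z T h g f => compmA h g f)
    (fun X Y f => comp1m f) (fun X Y f => compm1 f)
    (fun X Y Z a g g' f => compm_linl a g g' f)
    (fun X Y Z a g f f' => compm_linr a g f f').

Definition replete (k : fieldType) (C : lincat k) (P : set C) : Prop :=
  forall X Y : C, isomorphic X Y -> P X -> P Y.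

Section FullMonoidal.
Context {k : fieldType} (C : moncat k) (P : set C).

Record mon_closed : Prop := MonClosed {
  mon_unit : P unit;
  mon_tens : forall X Y : C, P X -> P Y -> P (X ⊗ Y) }.

Hypothesis h : mon_closed.
Let D := full_subcat P.

Definition sub_tens : bifunctor D D D :=
  @Bifunctor k D D D
    (fun X Y => exist P (sval X ⊗ sval Y) (mon_tens h (svalP X) (svalP Y)))
    (fun X X' Y Y' f g => f ⊗ₘ g)
    (fun X Y => bf_id tens (sval X) (sval Y))
    (fun X X' X'' Y Y' Y'' f' f g' g => bf_comp tens f' f g' g)
    (fun X X' Y Y' a f f' g => bf_linl tens a f f' g)
    (fun X X' Y Y' a f g g' => bf_linr tens a f g g').

Definition full_submon : moncat k :=
  @MonCat k D (exist P unit (mon_unit h)) sub_tens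
    (fun X Y Z => assoc (sval X) (sval Y) (sval Z))
    (fun X Y Z => associ (sval X) (sval Y) (sval Z))
    (fun X => lunit (sval X)) (fun X => runit (sval X))
    (fun X Y Z => assocK (sval X) (sval Y) (sval Z))
    (fun X => lunit_iso (sval X)) (fun X => runit_iso (sval X))
    (fun X X' Y Y' Z Z' f g h => assoc_nat f g h)
    (fun X X' f => lunit_nat f) (fun X X' f => runit_nat f)
    (fun W X Y Z => pentagon (sval W) (sval X) (sval Y) (sval Z))
    (fun X Y => triangle (sval X) (sval Y)).
End FullMonoidal.

Record fusion_subcat (k : fieldType) (C : moncat k) : Type := FusionSubcat {
  fs_set : set C;
  fs_replete : replete fs_set;
  fs_closed : mon_closed fs_set;
  fs_fusion : is_fusion (full_submon fs_closed) }.

Definition fs_cat (k : fieldType) (C : moncat k) (D : fusion_subcat C) :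
  fusion_cat k := FusionCat (fs_fusion D).
Coercion fs_cat : fusion_subcat >-> fusion_cat.

Record left_action (k : fieldType) (D : moncat k) (M : lincat k) : Type :=
  LeftAction {
  lact :> bifunctor D M M;
  lact_assoc : forall (X Y : D) (m : M), lact (X ⊗ Y) m ~> lact X (lact Y m);
  lact_unit : forall m : M, lact unit m ~> m;
  lact_assoc_iso : forall X Y m, is_iso (lact_assoc X Y m);
  lact_unit_iso : forall m, is_iso (lact_unit m);
  lact_assoc_nat : forall (X X' Y Y' : D) (m m' : M)
      (f : X ~> X') (g : Y ~> Y') (u : m ~> m'),
    lact_assoc X' Y' m' ∘ bf_hom lact (f ⊗ₘ g) u =
    bf_hom lact f (bf_hom lact g u) ∘ lact_assoc X Y m;
  lact_unit_nat : forall (m m' : M) (u : m ~> m'),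
    lact_unit m' ∘ bf_hom lact (idm unit) u = u ∘ lact_unit m;
  lact_pentagon : forall (X Y Z : D) (m : M),
    bf_hom lact (idm X) (lact_assoc Y Z m) ∘ lact_assoc X (Y ⊗ Z) m
      ∘ bf_hom lact (assoc X Y Z) (idm m) =
    lact_assoc X Y (lact Z m) ∘ lact_assoc (X ⊗ Y) Z m;
  lact_triangle : forall (X : D) (m : M),
    bf_hom lact (idm X) (lact_unit m) ∘ lact_assoc X unit m =
    bf_hom lact (runit X) (idm m) }.

(** A right action of [E] is a left action of [E] with the opposite monoidal
    structure. *)
Record right_action (k : fieldType) (E : moncat k) (M : lincat k) : Type :=
  RightAction {
  ract :> bifunctor M E M;
  ract_assoc : forall (m : M) (X Y : E), ract (ract m X) Y ~> ract m (X ⊗ Y);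
  ract_unit : forall m : M, ract m unit ~> m;
  ract_assoc_iso : forall m X Y, is_iso (ract_assoc m X Y);
  ract_unit_iso : forall m, is_iso (ract_unit m);
  ract_assoc_nat : forall (m m' : M) (X X' Y Y' : E)
      (u : m ~> m') (f : X ~> X') (g : Y ~> Y'),
    ract_assoc m' X' Y' ∘ bf_hom ract (bf_hom ract u f) g =
    bf_hom ract u (f ⊗ₘ g) ∘ ract_assoc m X Y;
  ract_unit_nat : forall (m m' : M) (u : m ~> m'),
    ract_unit m' ∘ bf_hom ract u (idm unit) = u ∘ ract_unit m;
  ract_pentagon : forall (m : M) (X Y Z : E),
    bf_hom ract (idm m) (assoc X Y Z) ∘ ract_assoc m (X ⊗ Y) Z
      ∘ bf_hom ract (ract_assoc m X Y) (idm Z) =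
    ract_assoc m X (Y ⊗ Z) ∘ ract_assoc (ract m X) Y Z;
  ract_triangle : forall (m : M) (X : E),
    bf_hom ract (idm m) (lunit X) ∘ ract_assoc m unit X =
    bf_hom ract (ract_unit m) (idm X) }.

(** A module category over the Deligne product of [D] and the reverse of [E],
    spelled out through the universal property of that product: a left
    [D]-action, a right [E]-action and a middle associativity constraint
    coherent with the two associativity constraints (Etingof, Gelaki, Nikshych,
    Ostrik, Tensor Categories, Definition 7.1.7). *)
Record bimodcat (k : fieldType) (D E : moncat k) : Type := BimodCat {
  bm_cat :> lincat k;
  bm_semisimple : semisimple bm_cat;
  bm_l : left_action D bm_cat;
  bm_r : right_action E bm_cat;
  bm_mid : forall (X : D) (m : bm_cat) (Z : E),
    bm_r (bm_l X m) Z ~> bm_l X (bm_r m Z);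
  bm_mid_iso : forall X m Z, is_iso (bm_mid X m Z);
  bm_mid_nat : forall (X X' : D) (m m' : bm_cat) (Z Z' : E)
      (f : X ~> X') (u : m ~> m') (g : Z ~> Z'),
    bm_mid X' m' Z' ∘ bf_hom bm_r (bf_hom bm_l f u) g =
    bf_hom bm_l f (bf_hom bm_r u g) ∘ bm_mid X m Z;
  bm_mid_lact : forall (X Y : D) (m : bm_cat) (Z : E),
    bf_hom bm_l (idm X) (bm_mid Y m Z) ∘ bm_mid X (bm_l Y m) Z
      ∘ bf_hom bm_r (lact_assoc bm_l X Y m) (idm Z) =
    lact_assoc bm_l X Y (bm_r m Z) ∘ bm_mid (X ⊗ Y) m Z;
  bm_mid_ract : forall (X : D) (m : bm_cat) (Y Z : E),
    bf_hom bm_l (idm X) (ract_assoc bm_r m Y Z) ∘ bm_mid X (bm_r m Y) Z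
      ∘ bf_hom bm_r (bm_mid X m Y) (idm Z) =
    bm_mid X m (Y ⊗ Z) ∘ ract_assoc bm_r (bm_l X m) Y Z }.

Section RegularBimodule.
Context {k : fieldType} (C : fusion_cat k) (D E : fusion_subcat C).

Definition reg_lact : left_action D C :=
  @LeftAction k D C
    (@Bifunctor k D C C (fun X Y => sval X ⊗ Y)
      (fun X X' Y Y' => @bf_hom k C C C tens (sval X) (sval X') Y Y')
      (fun X Y => bf_id tens (sval X) Y)
      (fun X X' X'' => @bf_comp k C C C tens (sval X) (sval X') (sval X''))
      (fun X X' => @bf_linl k C C C tens (sval X) (sval X'))
      (fun X X' => @bf_linr k C C C tens (sval X) (sval X')))
    (fun X Y m => assoc (sval X) (sval Y) m)
    (fun m => lunit m)
    (fun X Y m => ex_intro _ _ (assocK (sval X) (sval Y) m))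
    (fun m => lunit_iso m)
    (fun X X' Y Y' => @assoc_nat k C (sval X) (sval X') (sval Y) (sval Y'))
    (fun m m' u => lunit_nat u)
    (fun X Y Z m => pentagon (sval X) (sval Y) (sval Z) m)
    (fun X m => triangle (sval X) m).

Definition reg_ract : right_action E C :=
  @RightAction k E C
    (@Bifunctor k C E C (fun X Y => X ⊗ sval Y)
      (fun X X' Y Y' => @bf_hom k C C C tens X X' (sval Y) (sval Y'))
      (fun X Y => bf_id tens X (sval Y))
      (fun X X' X'' Y Y' Y'' =>
         @bf_comp k C C C tens X X' X'' (sval Y) (sval Y') (sval Y''))
      (fun X X' Y Y' => @bf_linl k C C C tens X X' (sval Y) (sval Y'))
      (fun X X' Y Y' => @bf_linr k C C C tens X X' (sval Y) (sval Y')))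
    (fun m X Y => assoc m (sval X) (sval Y))
    (fun m => runit m)
    (fun m X Y => ex_intro _ _ (assocK m (sval X) (sval Y)))
    (fun m => runit_iso m)
    (fun m m' X X' Y Y' =>
       @assoc_nat k C m m' (sval X) (sval X') (sval Y) (sval Y'))
    (fun m m' u => runit_nat u)
    (fun m X Y Z => pentagon m (sval X) (sval Y) (sval Z))
    (fun m X => triangle m (sval X)).

Definition regular_bimod : bimodcat D E :=
  @BimodCat k D E C (fus_semisimple (fusP C)) reg_lact reg_ract
    (fun X m Z => assoc (sval X) m (sval Z))
    (fun X m Z => ex_intro _ _ (assocK (sval X) m (sval Z)))
    (fun X X' m m' Z Z' =>
       @assoc_nat k C (sval X) (sval X') m m' (sval Z) (sval Z'))
    (fun X Y m Z => pentagon (sval X) (sval Y) m (sval Z))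
    (fun X m Y Z => pentagon (sval X) m (sval Y) (sval Z)).
End RegularBimodule.

(** Sub-bimodule categories: full replete subcategories, semisimple abelian and
    stable under both actions. *)
Section SubBimodule.
Context {k : fieldType} {D E : moncat k} (M : bimodcat D E) (N : set M).

Record sub_bimodule : Prop := SubBimodule {
  sb_replete : replete N;
  sb_semisimple : semisimple (full_subcat N);
  sb_lact : forall (X : D) (m : M), N m -> N (bm_l M X m);
  sb_ract : forall (m : M) (Z : E), N m -> N (bm_r M m Z) }.

Hypothesis h : sub_bimodule.
Let N' := full_subcat N.

Definition sub_lact : left_action D N' :=
  let L := bm_l M in
  @LeftAction k D N'
    (@Bifunctor k D N' N'
      (fun X m => exist N (L X (sval m)) (sb_lact h X (svalP m)))
      (fun X X' m m' f u => bf_hom L f u)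
      (fun X m => bf_id L X (sval m))
      (fun X X' X'' m m' m'' f' f u' u => bf_comp L f' f u' u)
      (fun X X' m m' a f f' u => bf_linl L a f f' u)
      (fun X X' m m' a f u u' => bf_linr L a f u u'))
    (fun X Y m => lact_assoc L X Y (sval m))
    (fun m => lact_unit L (sval m))
    (fun X Y m => lact_assoc_iso L X Y (sval m))
    (fun m => lact_unit_iso L (sval m))
    (fun X X' Y Y' m m' f g u => lact_assoc_nat L f g u)
    (fun m m' u => lact_unit_nat L u)
    (fun X Y Z m => lact_pentagon L X Y Z (sval m))
    (fun X m => lact_triangle L X (sval m)).

Definition sub_ract : right_action E N' :=
  let R := bm_r M in
  @RightAction k E N'
    (@Bifunctor k N' E N'
      (fun m Z => exist N (R (sval m) Z) (sb_ract h Z (svalP m)))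
      (fun m m' Z Z' u g => bf_hom R u g)
      (fun m Z => bf_id R (sval m) Z)
      (fun m m' m'' Z Z' Z'' u' u g' g => bf_comp R u' u g' g)
      (fun m m' Z Z' a u u' g => bf_linl R a u u' g)
      (fun m m' Z Z' a u g g' => bf_linr R a u g g'))
    (fun m X Y => ract_assoc R (sval m) X Y)
    (fun m => ract_unit R (sval m))
    (fun m X Y => ract_assoc_iso R (sval m) X Y)
    (fun m => ract_unit_iso R (sval m))
    (fun m m' X X' Y Y' u f g => ract_assoc_nat R u f g)
    (fun m m' u => ract_unit_nat R u)
    (fun m X Y Z => ract_pentagon R (sval m) X Y Z)
    (fun m X => ract_triangle R (sval m) X).

Definition sub_bimod : bimodcat D E :=
  @BimodCat k D E N' (sb_semisimple h) sub_lact sub_ract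
    (fun X m Z => bm_mid X (sval m) Z)
    (fun X m Z => bm_mid_iso X (sval m) Z)
    (fun X X' m m' Z Z' f u g => bm_mid_nat f u g)
    (fun X Y m Z => bm_mid_lact X Y (sval m) Z)
    (fun X m Y Z => bm_mid_ract X (sval m) Y Z).
End SubBimodule.

(** [M] is the direct sum of its full subcategories [N i]: every object is a
    direct sum of objects [Y i] of [N i], and the Hom space from a direct sum of
    [X i] to a direct sum of [Y i] is the direct sum of the Hom spaces from [X i]
    to [Y i], i.e. there are no nonzero morphisms between distinct [N i]. *)
Definition direct_sum_decomposition (k : fieldType) (M : lincat k)
    (I : finType) (N : I -> set M) : Prop :=
  (forall X : M, exists Y : I -> M,
     (forall i, N i (Y i)) /\ is_direct_sum Y X) /\
  (forall i j, i != j -> forall X Y : M, N i X -> N j Y ->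
     forall f : X ~> Y, f = 0).

Definition nontrivial (k : fieldType) (M : lincat k) (N : set M) : Prop :=
  exists X : M, N X /\ ~ zero_object X.

Definition indecomposable (k : fieldType) (D E : moncat k)
    (M : bimodcat D E) : Prop :=
  ~ exists N : 'I_2 -> set M,
      [/\ forall i, sub_bimodule (N i), forall i, nontrivial (N i)
        & direct_sum_decomposition N].

Section DoubleCosets.
Context {k : fieldType} (C : fusion_cat k) (D E : fusion_subcat C).

Definition coset_rel (x y : Lambda C) : Prop :=
  exists (d : Lambda D) (e : Lambda E) (A : D) (X Y : C) (B : E),
    [/\ sval d A, sval e B, sval x X, sval y Y
      & factor Y (sval A ⊗ X ⊗ sval B)].

Definition double_coset (B : set (Lambda C)) : Prop :=
  exists x, B = [set y | coset_rel x y].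

Definition double_coset_subcat (B : set (Lambda C)) : set C :=
  [set X | exists n (S : 'I_n -> C),
     (forall i, exists b, B b /\ sval b (S i)) /\ is_direct_sum S X].

Definition enumerates_double_cosets (l : nat)
    (B : 'I_l -> set (Lambda C)) : Prop :=
  injective B /\ forall b, double_coset b <-> exists i, B i = b.
End DoubleCosets.

(* Main.v *)
Require Import Defs.
From mathcomp Require Import all_boot all_algebra.
From mathcomp Require Import boolp classical_sets.

(** In a semisimple category every morphism f is von Neumann regular
    (f g f = f for some g), and a full subcategory closed under finite sums and
    retracts inherits this together with the splitting of idempotents, which is
    enough for it to be semisimple abelian. An object lies in the subcategory of
    a double coset iff every simple object with a nonzero morphism to it has its
    class in that coset, so these closure properties and the vanishing of Hom
    between distinct cosets are immediate. Symmetry of ~ is the duality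
    Hom(A X B, Y) = Hom(X, A' Y B'). If a double coset subcategory split into two
    nonzero sub-bimodules, pick simple summands S and T of an object X of the
    first and an object Y of the second: T is a retract of some A S B, and
    A X B -> A S B -> T -> Y is a nonzero morphism between the two. *)

Set Implicit Arguments.
Unset Strict Implicit.
Unset Printing Implicit Defensive.

Import GRing.Theory.
Local Open Scope ring_scope.
Local Open Scope lincat_scope.

(** * Linear categories: nonzero morphisms, sections and isomorphisms *)

Lemma sum_neq0 (V : nmodType) (I : finType) (P : pred I) (F : I -> V) :
  \sum_(i | P i) F i != 0 -> exists2 i, P i & F i != 0.
Proof.
move=> nz; apply: contrapT => h; case/negP: nz; apply/eqP/big1 => i Pi.
by apply/eqP; apply: contraT => Fi; case: h; exists i.
Qed.

Section LinearCategory.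
Context {k : fieldType} {C : lincat k}.
Implicit Types X Y Z : C.

Lemma comp0m X Y Z (f : X ~> Y) : (0 : Y ~> Z) ∘ f = 0.
(* With the scalar -1 the linearity axiom reads [0 ∘ f = - (0 ∘ f) + 0 ∘ f]. *)
Proof. by have := compm_linl (-1) 0 (0 : Y ~> Z) f; rewrite !scaleN1r !addNr. Qed.

Lemma compm0 X Y Z (g : Y ~> Z) : g ∘ (0 : X ~> Y) = 0.
Proof. by have := compm_linr (-1) g (0 : X ~> Y) 0; rewrite !scaleN1r !addNr. Qed.

Lemma compmDl X Y Z (g g' : Y ~> Z) (f : X ~> Y) :
  (g + g') ∘ f = g ∘ f + g' ∘ f.
Proof. by have := compm_linl 1 g g' f; rewrite !scale1r. Qed.

Lemma compmDr X Y Z (g : Y ~> Z) (f f' : X ~> Y) :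
  g ∘ (f + f') = g ∘ f + g ∘ f'.
Proof. by have := compm_linr 1 g f f'; rewrite !scale1r. Qed.

Lemma compmBl X Y Z (g g' : Y ~> Z) (f : X ~> Y) :
  (g - g') ∘ f = g ∘ f - g' ∘ f.
Proof.
by have := compm_linl (-1) g' g f; rewrite !scaleN1r addrC => ->; rewrite addrC.
Qed.

Lemma compmBr X Y Z (g : Y ~> Z) (f f' : X ~> Y) :
  g ∘ (f - f') = g ∘ f - g ∘ f'.
Proof.
by have := compm_linr (-1) g f' f; rewrite !scaleN1r addrC => ->; rewrite addrC.
Qed.

Lemma compm_suml (I : finType) (P : pred I) X Y Z (g : I -> (Y ~> Z))
    (f : X ~> Y) :
  (\sum_(i | P i) g i) ∘ f = \sum_(i | P i) (g i ∘ f).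
Proof.
by apply: (big_morph (fun g => g ∘ f)) => [g1 g2|]; rewrite ?compmDl ?comp0m.
Qed.

Lemma compm_sumr (I : finType) (P : pred I) X Y Z (g : Y ~> Z)
    (f : I -> (X ~> Y)) :
  g ∘ (\sum_(i | P i) f i) = \sum_(i | P i) (g ∘ f i).
Proof.
by apply: (big_morph (fun f => g ∘ f)) => [f1 f2|]; rewrite ?compmDr ?compm0.
Qed.

Lemma comp_neq0l X Y Z (g : Y ~> Z) (f : X ~> Y) : g ∘ f != 0 -> f != 0.
Proof. by apply: contraNneq => ->; rewrite compm0. Qed.

Lemma comp_neq0r X Y Z (g : Y ~> Z) (f : X ~> Y) : g ∘ f != 0 -> g != 0.
Proof. by apply: contraNneq => ->; rewrite comp0m. Qed.

Lemma section_comp_neq0 X Y Z (r : Z ~> Y) (s : Y ~> Z) (f : X ~> Y) :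
  r ∘ s = idm Y -> f != 0 -> s ∘ f != 0.
Proof. by move=> rs f0; apply: (@comp_neq0l _ _ _ r); rewrite compmA rs comp1m. Qed.

Lemma section_neq0 X Y (r : Y ~> X) (s : X ~> Y) :
  r ∘ s = idm X -> idm X != 0 -> s != 0.
Proof. by move=> rs /(section_comp_neq0 rs); rewrite compm1. Qed.

Lemma comp_retraction_neq0 X Y Z (r : X ~> Y) (s : Y ~> X) (f : Y ~> Z) :
  r ∘ s = idm Y -> f != 0 -> f ∘ r != 0.
Proof. by move=> rs f0; apply: (@comp_neq0r _ _ _ _ s); rewrite -compmA rs compm1. Qed.

Lemma section_mono X Y (r : X ~> Y) (s : Y ~> X) : r ∘ s = idm Y -> mono s.
Proof.
by move=> rs Z u v /(congr1 (compm r)); rewrite !compmA rs !comp1m.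
Qed.

Lemma iso_comp_neq0 X Y Z (g : Y ~> Z) (f : X ~> Y) :
  is_iso g -> f != 0 -> g ∘ f != 0.
Proof. by case=> g' [gK _]; apply: section_comp_neq0 gK. Qed.

Lemma comp_iso_neq0 X Y Z (g : Y ~> Z) (f : X ~> Y) :
  is_iso f -> g != 0 -> g ∘ f != 0.
Proof. by case=> f' [_ fK]; apply: comp_retraction_neq0 fK. Qed.

Lemma is_iso_id X : is_iso (idm X).
Proof. by exists (idm X); rewrite /inverse comp1m. Qed.

Lemma is_iso_inv X Y (f : X ~> Y) (g : Y ~> X) : inverse f g -> is_iso g.
Proof. by move=> [gf fg]; exists f. Qed.

Lemma is_iso_comp X Y Z (g : Y ~> Z) (f : X ~> Y) :
  is_iso g -> is_iso f -> is_iso (g ∘ f).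
Proof.
move=> [g' [gK g'K]] [f' [fK f'K]]; exists (f' ∘ g'); split.
  by rewrite -compmA (compmA g') gK comp1m.
by rewrite -compmA (compmA f) f'K comp1m.
Qed.

Lemma isomorphic_refl X : isomorphic X X.
Proof. by exists (idm X); apply: is_iso_id. Qed.

Lemma isomorphic_sym X Y : isomorphic X Y -> isomorphic Y X.
Proof. by case=> f [g [fK gK]]; exists g, f. Qed.

Lemma isomorphic_trans X Y Z :
  isomorphic X Y -> isomorphic Y Z -> isomorphic X Z.
Proof. by move=> [f fi] [g gi]; exists (g ∘ f); apply: is_iso_comp. Qed.

Lemma iso_classP X Y : isomorphic X Y -> iso_class X = iso_class Y.
Proof.
move=> XY; apply/seteqP; split=> Z; apply: isomorphic_trans => //.
exact: isomorphic_sym.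
Qed.

(** * Zero objects, simple objects and their isomorphism classes *)

Lemma zero_objectP X : zero_object X <-> idm X = 0.
Proof.
split=> [/(_ X)[h _]|id0 Y]; first exact: h.
by split=> f; [rewrite -(compm1 f) id0 compm0 | rewrite -(comp1m f) id0 comp0m].
Qed.

Lemma simple_id_neq0 X : simple X -> idm X != 0.
Proof. by case=> nz _; apply/eqP => /zero_objectP. Qed.

Lemma iso_simple X Y : isomorphic X Y -> simple X -> simple Y.
Proof.
move=> [f [g [fK gK]]] [X0 sX]; split.
  move=> /zero_objectP Y0; apply: X0; apply/zero_objectP.
  by rewrite -fK -(comp1m f) Y0 comp0m compm0.
move=> Z h mh.
have mgh : mono (g ∘ h).
  by move=> W u v; rewrite -!compmA => /(section_mono gK)/mh.
case: (sX _ _ mgh) => [|ghi]; [by left | right].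
rewrite -(comp1m h) -gK -compmA; apply: is_iso_comp => //.
by exists g.
Qed.

Definition simple_class X (sX : simple X) : Lambda C :=
  exist _ (iso_class X) (ex_intro _ X (conj sX erefl)).

Lemma simple_class_eq X Y (sX : simple X) (sY : simple Y) :
  isomorphic X Y -> simple_class sX = simple_class sY.
Proof. by move=> XY; apply: eq_exist; apply: iso_classP. Qed.

Lemma Lambda_mem (x : Lambda C) X :
  sval x X -> exists sX : simple X, x = simple_class sX.
Proof.
case: x => c [Y [sY ec]] /= cX; have YX : isomorphic Y X by rewrite ec in cX.
exists (iso_simple YX sY); apply: eq_exist => /=.
by rewrite ec; apply: iso_classP.
Qed.

Lemma Lambda_rep (x : Lambda C) : exists X (sX : simple X), x = simple_class sX.
Proof.
have [X [sX ex]] := svalP x; exists X.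
by apply: Lambda_mem; rewrite ex; apply: isomorphic_refl.
Qed.

(** * Von Neumann regularity as a route to abelian categories *)

Definition split_idempotents (A : lincat k) : Prop :=
  forall (X : A) (e : X ~> X), e ∘ e = e ->
    exists (Y : A) (s : Y ~> X) (r : X ~> Y), r ∘ s = idm Y /\ s ∘ r = e.

Definition von_neumann_regular (A : lincat k) : Prop :=
  forall (X Y : A) (f : X ~> Y), exists g, f ∘ g ∘ f = f.

Lemma idempotent_compl X (e : X ~> X) :
  e ∘ e = e -> (idm X - e) ∘ (idm X - e) = idm X - e.
Proof. by move=> ee; rewrite compmBl !compmBr !compm1 comp1m ee subrr subr0. Qed.

(** McCoy's lemma: regularity of [h = f - f ∘ x ∘ f] gives that of [f]. Since [h] is both
    [f ∘ (idm X - x ∘ f)] and [(idm Y - f ∘ x) ∘ f], the witness below gives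
    [h ∘ y ∘ h + f ∘ x ∘ f = f]. *)
Lemma mccoy X Y (f : X ~> Y) (x y : Y ~> X) :
  (f - f ∘ x ∘ f) ∘ y ∘ (f - f ∘ x ∘ f) = f - f ∘ x ∘ f ->
  exists g, f ∘ g ∘ f = f.
Proof.
have hl : f ∘ (idm X - x ∘ f) = f - f ∘ x ∘ f by rewrite compmBr compm1 compmA.
have hr : (idm Y - f ∘ x) ∘ f = f - f ∘ x ∘ f by rewrite compmBl comp1m.
move=> hyh; exists ((idm X - x ∘ f) ∘ y ∘ (idm Y - f ∘ x) + x).
rewrite compmDr compmDl (compmA f) (compmA f) hl -(compmA _ _ f) hr hyh.
by rewrite subrK.
Qed.

(** When [f ∘ g ∘ f = f], splitting the idempotent [idm X - g ∘ f] yields a kernel of [f], and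
    splitting [idm Y - f ∘ g] a cokernel. A mono [i] with quasi-inverse [g] satisfies
    [g ∘ i = idm K], hence is a kernel of [idm X - i ∘ g]; epis are dual. *)
Lemma regular_abelian :
  (forall n (Y : 'I_n -> C), exists X, is_direct_sum Y X) ->
  split_idempotents C -> von_neumann_regular C -> abelian C.
Proof.
move=> sums splits reg; split=> // [X Y f|X Y f|K X i mi|Y K p ep].
- have [g fgf] := reg _ _ f.
  have /splits[K [s [r [rs sr]]]] : (idm X - g ∘ f) ∘ (idm X - g ∘ f) = idm X - g ∘ f.
    by apply: idempotent_compl; rewrite -compmA (compmA f) fgf.
  exists K, s; split.
    rewrite -(compm1 s) -rs (compmA s) sr compmA compmBr compm1 compmA fgf.
    by rewrite subrr comp0m.
  move=> Z h fh; exists (r ∘ h); split.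
    by rewrite compmA sr compmBl comp1m -compmA fh compm0 subr0.
  by move=> h' <-; rewrite compmA rs comp1m.
- have [g fgf] := reg _ _ f.
  have /splits[K [s [r [rs sr]]]] : (idm Y - f ∘ g) ∘ (idm Y - f ∘ g) = idm Y - f ∘ g.
    by apply: idempotent_compl; rewrite compmA fgf.
  exists K, r; split.
    rewrite -(comp1m r) -rs -(compmA r) sr -compmA compmBl comp1m fgf.
    by rewrite subrr compm0.
  move=> Z h hf; exists (h ∘ s); split.
    by rewrite -compmA sr compmBr compm1 compmA hf comp0m subr0.
  by move=> h' <-; rewrite -compmA rs compm1.
- have [g igi] := reg _ _ i.
  have gi : g ∘ i = idm K by apply: mi; rewrite compmA igi compm1.
  exists X, (idm X - i ∘ g); split.
    by rewrite compmBl comp1m igi subrr.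
  move=> Z h; rewrite compmBl comp1m => /eqP; rewrite subr_eq0 => /eqP ih.
  exists (g ∘ h); split; first by rewrite compmA -ih.
  by move=> h' <-; rewrite compmA gi comp1m.
- have [g pgp] := reg _ _ p.
  have pg : p ∘ g = idm K by apply: ep; rewrite pgp comp1m.
  exists Y, (idm Y - g ∘ p); split.
    by rewrite compmBr compm1 compmA pgp subrr.
  move=> Z h; rewrite compmBr compm1 => /eqP; rewrite subr_eq0 => /eqP hp.
  exists (h ∘ g); split; first by rewrite -compmA -hp.
  by move=> h' <-; rewrite -compmA pg compm1.
Qed.

(** An idempotent [e] splits through the kernel of [idm X - e]. *)
Lemma abelian_split_idempotents : abelian C -> split_idempotents C.
Proof.
move=> ab X e ee; have [K [s [es0 sP]]] := ab_ker ab (idm X - e).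
have es : e ∘ s = s.
  by move/eqP: es0; rewrite compmBl comp1m subr_eq0 => /eqP.
have [r [sr _]] : exists! r, s ∘ r = e.
  by apply: sP; rewrite compmBl comp1m ee subrr.
exists K, s, r; split=> //.
(* Both [idm K] and [r ∘ s] factor [s] through itself, so they coincide. *)
have [t [_ tU]] := sP _ s es0.
by rewrite -(tU (idm K)) ?compm1 // -(tU (r ∘ s)) // compmA sr.
Qed.

(** Stated for any resolution of the identity, so that it also applies to the image of a direct sum
    under a tensor functor. *)
Lemma direct_sum_neq0r (I : finType) (S : I -> C) (X T : C)
    (inj : forall i, S i ~> X) (proj : forall i, X ~> S i) (t : T ~> X) :
  \sum_i (inj i ∘ proj i) = idm X -> t != 0 -> exists i, proj i ∘ t != 0.
Proof.
move=> e; rewrite -{1}(comp1m t) -e compm_suml => /sum_neq0[i _].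
by rewrite -compmA => /comp_neq0l; exists i.
Qed.

Lemma direct_sum_neq0l (I : finType) (S : I -> C) (X T : C)
    (inj : forall i, S i ~> X) (proj : forall i, X ~> S i) (t : X ~> T) :
  \sum_i (inj i ∘ proj i) = idm X -> t != 0 -> exists i, t ∘ inj i != 0.
Proof.
move=> e; rewrite -{1}(compm1 t) -e compm_sumr => /sum_neq0[i _].
by rewrite compmA => /comp_neq0r; exists i.
Qed.

Lemma factor_neq0 X Y : factor X Y -> idm X != 0 -> exists f : X ~> Y, f != 0.
Proof.
move=> [X' [inj [proj [pi _ _]]]] X0; exists (inj true).
by apply: (@comp_neq0l _ _ _ (proj true)); rewrite (pi true).
Qed.

(** The complementary summand is obtained by splitting [idm Y - s ∘ r]. *)
Lemma retract_factor X Y (s : X ~> Y) (r : Y ~> X) :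
  split_idempotents C -> r ∘ s = idm X -> factor X Y.
Proof.
move=> splits rs.
have /splits[X' [s' [r' [rs' sr']]]] :
    (idm Y - s ∘ r) ∘ (idm Y - s ∘ r) = idm Y - s ∘ r.
  by apply: idempotent_compl; rewrite compmA -(compmA s) rs compm1.
exists X', (fun b => if b return (if b then X else X') ~> Y then s else s'),
  (fun b => if b return Y ~> (if b then X else X') then r else r').
split; first by case.
- case=> [] [] //= _.
    rewrite -(compm1 s') -rs' (compmA s') sr' compmA compmBr (compmA r s r) rs.
    by rewrite compm1 comp1m subrr comp0m.
  rewrite -(comp1m r') -rs' -(compmA r') sr' -compmA compmBl -(compmA s r s) rs.
  by rewrite compm1 comp1m subrr compm0.
by rewrite big_bool /= sr' addrC subrK.
Qed.

End LinearCategory.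

(** * Schur's lemma and its consequences in semisimple categories *)

Section Semisimple.
Context {k : fieldType} {C : lincat k}.
Hypothesis ssC : semisimple C.
Implicit Types X Y Z S T : C.

(** The kernel of [f] is a subobject of [S], and it is not all of [S] because [f] is nonzero. So it
    vanishes, [f] is mono, and simplicity of [T] makes [f] an isomorphism. *)
Lemma schur S T (f : S ~> T) : simple S -> simple T -> f != 0 -> is_iso f.
Proof.
case: ssC => ab _ [S0 sS] [_ sT] f0.
have [K [i [fi0 iP]]] := ab_ker ab f.
have mi : mono i.
  move=> Z g g' e; have [h [_ hU]] : exists! h, i ∘ h = i ∘ g.
    by apply: iP; rewrite compmA fi0 comp0m.
  by rewrite -(hU g) // -(hU g').
case: (sS _ _ mi) => [K0|[j [_ ij]]]; last first.
  by case/eqP: f0; rewrite -(compm1 f) -ij compmA fi0 comp0m.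
have mf : mono f.
  move=> Z g g' e; apply/eqP; rewrite -subr_eq0; apply/eqP.
  have [h [<- _]] : exists! h, i ∘ h = g - g'.
    by apply: iP; rewrite compmBr e subrr.
  by rewrite (proj2 (K0 Z) h) compm0.
by case: (sT _ _ mf).
Qed.

Lemma simple_retract S X (f : S ~> X) :
  simple S -> f != 0 -> exists r : X ~> S, r ∘ f = idm S.
Proof.
move=> sS f0; have [n [T [sT [inj [proj [_ _ e]]]]]] := proj2 ssC X.
have [i nz] := direct_sum_neq0r e f0.
have [g [gK _]] := schur sS (sT i) nz.
by exists (g ∘ proj i); rewrite -compmA.
Qed.

(* In McCoy's lemma take x to factor through a retraction of a nonzero component
   f inj_i: the component of f - f x f at i vanishes. *)
Lemma semisimple_regular : von_neumann_regular C.
Proof.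
move=> X Y f; have [n [S [sS [inj [proj [_ _ e]]]]]] := proj2 ssC X.
(* Induction on the number of simple summands of [X] on which [f] is nonzero. *)
have [m] := ubnP #|[set i | f ∘ inj i != 0]%SET|; elim: m f => // m IH f.
rewrite ltnS => le_m.
have [->|f0] := eqVneq f 0; first by exists 0; rewrite compm0.
have [i nz] := direct_sum_neq0l e f0.
have [r rf] := simple_retract (sS i) nz.
pose h := f - f ∘ (inj i ∘ r) ∘ f.
have [|y hyh] := IH h.
  apply: leq_trans le_m; apply/proper_card/properP; split.
    apply/fintype.subsetP => j; rewrite !inE; apply: contraNneq => fj.
    by rewrite /h compmBl -compmA fj compm0 subrr.
  exists i; rewrite !inE // negbK /h compmBl.
  by rewrite (compmA f) -!compmA rf compm1 subrr.
exact: mccoy hyh.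
Qed.

(** * Semisimplicity of full subcategories *)

Section FullSubcategory.
Variable P : set C.
Hypothesis P_retract : forall X Y (s : X ~> Y) (r : Y ~> X),
  r ∘ s = idm X -> P Y -> P X.
Hypothesis P_sum : forall n (S : 'I_n -> C) X,
  (forall i, P (S i)) -> is_direct_sum S X -> P X.
Hypothesis P_simples : forall X, P X -> exists n (S : 'I_n -> C),
  (forall i, simple (S i)) /\ is_direct_sum S X.

(** Quasi-inverses are inherited by fullness; the objects splitting idempotents and the simple
    summands are retracts, hence again in [P]. *)
Lemma full_subcat_semisimple : semisimple (full_subcat P).
Proof.
have [ab _] := ssC.
have reg : von_neumann_regular (full_subcat P).
  by move=> X Y f; exact: (semisimple_regular f).
(* A mono of the subcategory is not a priori mono in [C]; regularity turns it into a section, and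
   sections stay mono in [C]. *)
have simpleP (X : full_subcat P) : simple (sval X) -> simple X.
  case=> X0 sX; split.
    by move=> /zero_objectP id0; apply: X0; apply/zero_objectP.
  move=> Y f mf; have [g fgf] := reg _ _ f.
  have gf : g ∘ f = idm Y by apply: mf; rewrite compmA fgf compm1.
  have mf' := @section_mono k C (sval X) (sval Y) g f gf.
  case: (sX _ _ mf') => [/zero_objectP Y0|fi]; last by right; exact: fi.
  by left; apply/zero_objectP.
split.
  apply: regular_abelian => // [n Y|X e ee].
    have [X dX] := ab_sum ab (fun i => sval (Y i)).
    exists (exist _ X (P_sum (fun i => svalP (Y i)) dX)); exact: dX.
  have [Y [s [r [rs sr]]]] :=
    abelian_split_idempotents ab (ee : (e : sval X ~> sval X) ∘ e = e).
  by exists (exist _ Y (P_retract rs (svalP X))), s, r.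
move=> X; have [n [S [sS dS]]] := P_simples (svalP X).
have PS i : P (S i).
  have [inj [proj [pi _ _]]] := dS.
  exact: P_retract (pi i) (svalP X).
exists n, (fun i => exist _ (S i) (PS i)); split=> [i|].
  exact: (simpleP (exist P (S i) (PS i)) (sS i)).
exact: dS.
Qed.

End FullSubcategory.
End Semisimple.

(** * Bifunctors: additivity, retracts and isomorphisms *)

Section Bifunctor.
Context {k : fieldType} {A B C : lincat k} (F : bifunctor A B C).

Lemma bf_hom0l X X' Y Y' (g : Y ~> Y') : bf_hom F (0 : X ~> X') g = 0.
Proof. by have := bf_linl F (-1) (0 : X ~> X') 0 g; rewrite !scaleN1r !addNr. Qed.

Lemma bf_hom0r X X' Y Y' (f : X ~> X') : bf_hom F f (0 : Y ~> Y') = 0.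
Proof. by have := bf_linr F (-1) f (0 : Y ~> Y') 0; rewrite !scaleN1r !addNr. Qed.

Lemma bf_hom_suml (I : finType) X X' Y Y' (f : I -> (X ~> X')) (g : Y ~> Y') :
  bf_hom F (\sum_i f i) g = \sum_i bf_hom F (f i) g.
Proof.
apply: (big_morph (fun f => bf_hom F f g)) => [f1 f2|]; last exact: bf_hom0l.
by have := bf_linl F 1 f1 f2 g; rewrite !scale1r.
Qed.

Lemma bf_hom_sumr (I : finType) X X' Y Y' (f : X ~> X') (g : I -> (Y ~> Y')) :
  bf_hom F f (\sum_i g i) = \sum_i bf_hom F f (g i).
Proof.
apply: (big_morph (fun g => bf_hom F f g)) => [g1 g2|]; last exact: bf_hom0r.
by have := bf_linr F 1 f g1 g2; rewrite !scale1r.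
Qed.

Lemma bf_hom_retractl X X' Y (s : X ~> X') (r : X' ~> X) :
  r ∘ s = idm X ->
  bf_hom F r (idm Y) ∘ bf_hom F s (idm Y) = idm (F X Y).
Proof. by move=> rs; rewrite -bf_comp rs comp1m bf_id. Qed.

Lemma bf_hom_retractr X Y Y' (s : Y ~> Y') (r : Y' ~> Y) :
  r ∘ s = idm Y ->
  bf_hom F (idm X) r ∘ bf_hom F (idm X) s = idm (F X Y).
Proof. by move=> rs; rewrite -bf_comp rs comp1m bf_id. Qed.

Lemma is_iso_bf_hom X X' Y Y' (f : X ~> X') (g : Y ~> Y') :
  is_iso f -> is_iso g -> is_iso (bf_hom F f g).
Proof.
move=> [f' [fK f'K]] [g' [gK g'K]]; exists (bf_hom F f' g').
by split; rewrite -bf_comp ?fK ?gK ?f'K ?g'K bf_id.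
Qed.

End Bifunctor.

(** * Associators and transposition along duals *)

Section MonoidalCategory.
Context {k : fieldType} {C : moncat k}.
Implicit Types U V X Y Z : C.

Lemma assoc_iso X Y Z : is_iso (assoc X Y Z).
Proof. exact: ex_intro (assocK X Y Z). Qed.

Lemma associ_iso X Y Z : is_iso (associ X Y Z).
Proof. exact: is_iso_inv (assocK X Y Z). Qed.

Lemma associ_nat X X' Y Y' Z Z' (f : X ~> X') (g : Y ~> Y') (h : Z ~> Z') :
  associ X' Y' Z' ∘ (f ⊗ₘ (g ⊗ₘ h)) = (f ⊗ₘ g) ⊗ₘ h ∘ associ X Y Z.
Proof.
have [aK _] := assocK X' Y' Z'; have [_ aiK] := assocK X Y Z.
by rewrite -[f ⊗ₘ (g ⊗ₘ h)]compm1 -aiK (compmA _ (assoc X Y Z)) -assoc_nat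
  !compmA aK comp1m.
Qed.

Lemma pentagon_associ W X Y Z :
  (idm W ⊗ₘ assoc X Y Z) ∘ assoc W (X ⊗ Y) Z =
  assoc W X (Y ⊗ Z) ∘ assoc (W ⊗ X) Y Z ∘ (associ W X Y ⊗ₘ idm Z).
Proof.
have [_ aiK] := assocK W X Y.
by rewrite -pentagon -compmA -bf_comp aiK comp1m bf_id compm1.
Qed.

Lemma pentagon_associ_l W X Y Z :
  assoc (W ⊗ X) Y Z ∘ (associ W X Y ⊗ₘ idm Z) ∘ associ W (X ⊗ Y) Z =
  associ W X (Y ⊗ Z) ∘ (idm W ⊗ₘ assoc X Y Z).
Proof.
have [aK _] := assocK W X (Y ⊗ Z); have [_ aiK] := assocK W (X ⊗ Y) Z.
rewrite -[RHS]compm1 -aiK (compmA _ (assoc W (X ⊗ Y) Z)).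
rewrite -(compmA (associ _ _ _) _ (assoc W (X ⊗ Y) Z)) pentagon_associ.
by rewrite !compmA aK comp1m.
Qed.

(* f is recovered, up to isomorphisms, from its transpose U -> A' ⊗ V. *)
Lemma transpose_l_neq0 (A A' U V : C) (f : A ⊗ U ~> V) :
  left_dual A' A -> f != 0 -> exists g : U ~> A' ⊗ V, g != 0.
Proof.
move=> [ev [coev [_ snake]]] f0.
pose g := (idm A' ⊗ₘ f) ∘ assoc A' A U ∘ (coev ⊗ₘ idm U).
suff g0 : g != 0.
  have [lu luK] := lunit_iso U; exists (g ∘ lu).
  exact: comp_iso_neq0 (is_iso_inv luK) g0.
(* The snake composite from [A ⊗ unit] to [unit ⊗ A]: an isomorphism, since it agrees with [runit A]
   after [lunit A]. *)
pose s := (ev ⊗ₘ idm A) ∘ associ A A' A ∘ (idm A ⊗ₘ coev).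
have s_iso : is_iso s.
  have [lu luK] := lunit_iso A; have -> : s = lu ∘ runit A.
    by rewrite -snake !compmA (proj1 luK) comp1m.
  exact: is_iso_comp (is_iso_inv luK) (runit_iso A).
(* Transposing [g] back gives [f] tensored with the unit, preceded by isomorphisms; so [g = 0] would
   force [f = 0]. *)
have E : (ev ⊗ₘ idm V) ∘ associ A A' V ∘ (idm A ⊗ₘ g) ∘ assoc A unit U =
         (idm unit ⊗ₘ f) ∘ (assoc unit A U ∘ (s ⊗ₘ idm U)).
  have -> : idm A ⊗ₘ g =
      (idm A ⊗ₘ (idm A' ⊗ₘ f)) ∘ (idm A ⊗ₘ assoc A' A U)
        ∘ (idm A ⊗ₘ (coev ⊗ₘ idm U)) by rewrite -!bf_comp !comp1m.
  have -> : s ⊗ₘ idm U =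
      (ev ⊗ₘ idm A) ⊗ₘ idm U ∘ (associ A A' A ⊗ₘ idm U)
        ∘ ((idm A ⊗ₘ coev) ⊗ₘ idm U) by rewrite -!bf_comp !comp1m.
  rewrite !compmA -(compmA _ (assoc unit A U)) assoc_nat.
  rewrite (compmA (idm unit ⊗ₘ f)) -bf_comp comp1m bf_id compm1.
  rewrite -!compmA -assoc_nat (compmA (idm A ⊗ₘ assoc _ _ _)) pentagon_associ.
  rewrite (compmA (associ _ _ _)) associ_nat -!compmA.
  rewrite (compmA (associ A A' (A ⊗ U))) (proj1 (assocK _ _ _)) comp1m.
  by rewrite (compmA (ev ⊗ₘ idm V)) -bf_comp comp1m bf_id compm1.
have nz : (idm unit ⊗ₘ f) ∘ (assoc unit A U ∘ (s ⊗ₘ idm U)) != 0.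
  apply: comp_iso_neq0; first apply: is_iso_comp (assoc_iso _ _ _) _.
    exact: is_iso_bf_hom s_iso (is_iso_id _).
  apply: (@comp_neq0l _ _ _ _ _ (lunit V)); rewrite lunit_nat.
  exact: comp_iso_neq0 (lunit_iso _) f0.
by apply: contraNneq nz => g0; rewrite -E g0 bf_hom0r compm0 comp0m.
Qed.

(** Mirror image of [transpose_l_neq0], with the other snake identity. *)
Lemma transpose_r_neq0 (B B' U V : C) (f : U ⊗ B ~> V) :
  left_dual B B' -> f != 0 -> exists g : U ~> V ⊗ B', g != 0.
Proof.
move=> [ev [coev [snake _]]] f0.
pose g := (f ⊗ₘ idm B') ∘ associ U B B' ∘ (idm U ⊗ₘ coev).
suff g0 : g != 0.
  have [ru ruK] := runit_iso U; exists (g ∘ ru).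
  exact: comp_iso_neq0 (is_iso_inv ruK) g0.
pose s := (idm B ⊗ₘ ev) ∘ assoc B B' B ∘ (coev ⊗ₘ idm B).
have s_iso : is_iso s.
  have [ru ruK] := runit_iso B; have -> : s = ru ∘ lunit B.
    by rewrite -snake !compmA (proj1 ruK) comp1m.
  exact: is_iso_comp (is_iso_inv ruK) (lunit_iso B).
have E : (idm V ⊗ₘ ev) ∘ assoc V B' B ∘ (g ⊗ₘ idm B) ∘ associ U unit B =
         (f ⊗ₘ idm unit) ∘ (associ U B unit ∘ (idm U ⊗ₘ s)).
  have -> : g ⊗ₘ idm B =
      ((f ⊗ₘ idm B') ⊗ₘ idm B) ∘ (associ U B B' ⊗ₘ idm B)
        ∘ ((idm U ⊗ₘ coev) ⊗ₘ idm B) by rewrite -!bf_comp !comp1m.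
  have -> : idm U ⊗ₘ s =
      (idm U ⊗ₘ (idm B ⊗ₘ ev)) ∘ (idm U ⊗ₘ assoc B B' B)
        ∘ (idm U ⊗ₘ (coev ⊗ₘ idm B)) by rewrite -!bf_comp !comp1m.
  rewrite !compmA -(compmA _ (associ U B unit)) associ_nat.
  rewrite (compmA (f ⊗ₘ idm unit)) -bf_comp comp1m bf_id compm1.
  rewrite -!compmA -associ_nat (compmA (assoc _ _ _)) assoc_nat -!compmA.
  rewrite (compmA (idm V ⊗ₘ ev)) -bf_comp comp1m bf_id compm1.
  by rewrite (compmA (associ U B B' ⊗ₘ _)) (compmA (assoc (U ⊗ B) B' B))
    (compmA (assoc (U ⊗ B) B' B)) pentagon_associ_l -!compmA.
have nz : (f ⊗ₘ idm unit) ∘ (associ U B unit ∘ (idm U ⊗ₘ s)) != 0.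
  apply: comp_iso_neq0; first apply: is_iso_comp (associ_iso _ _ _) _.
    exact: is_iso_bf_hom (is_iso_id _) s_iso.
  apply: (@comp_neq0l _ _ _ _ _ (runit V)); rewrite runit_nat.
  exact: comp_iso_neq0 (runit_iso _) f0.
by apply: contraNneq nz => g0; rewrite -E g0 bf_hom0l compm0 comp0m.
Qed.

End MonoidalCategory.

(** * The double coset relation through nonzero morphisms *)

Section DoubleCosets.
Context {k : fieldType} {C : fusion_cat k} (D E : fusion_subcat C).
Implicit Types S T X Y Z : C.

Let ssC : semisimple C := fus_semisimple (fusP C).

(* For simple X and Y this is the relation X ~ Y, freed of the requirement that
   A and B be simple. *)
Definition linked X Y : Prop :=
  exists A B : C, [/\ fs_set D A, fs_set E B & exists f : Y ~> A ⊗ X ⊗ B, f != 0].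

(** The summands are simple in [F], as membership in [Lambda F] requires; the direct sum passes to
    [C] because the subcategory is full. *)
Lemma fusion_subcat_decomp (F : fusion_subcat C) (A : C) : fs_set F A ->
  exists n (S : 'I_n -> F),
    (forall i, simple (S i)) /\ is_direct_sum (fun i => sval (S i)) A.
Proof.
move=> FA.
have [n [S [sS dS]]] := proj2 (fus_semisimple (fs_fusion F)) (exist _ A FA).
by exists n, S; split=> //; exact: dS.
Qed.

Lemma linked_iso X X' Y Y' :
  isomorphic X X' -> isomorphic Y Y' -> linked X Y -> linked X' Y'.
Proof.
move=> [u ui] /isomorphic_sym[v vi] [A [B [DA EB [f f0]]]].
exists A, B; split=> //; exists ((idm A ⊗ₘ u) ⊗ₘ idm B ∘ f ∘ v).
apply: comp_iso_neq0 => //; apply: iso_comp_neq0 => //.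
by do 2?apply: is_iso_bf_hom => //; apply: is_iso_id.
Qed.

Lemma linked_refl X : simple X -> linked X X.
Proof.
move=> sX; exists unit, unit; split; [exact: mon_unit (fs_closed D)
  | exact: mon_unit (fs_closed E) |].
have [l lK] := lunit_iso X; have [r rK] := runit_iso (unit ⊗ X).
exists (r ∘ l); apply: iso_comp_neq0 (is_iso_inv rK) _.
by rewrite -(compm1 l); apply: iso_comp_neq0 (is_iso_inv lK) (simple_id_neq0 sX).
Qed.

(** Being simple, [Y] is a retract of [A ⊗ X ⊗ B]. Hence [A' ⊗ Y ⊗ B'] is a retract of
    [A' ⊗ (A ⊗ X ⊗ B) ⊗ B'], which is then reassociated. *)
Lemma linked_trans X Y Z : simple Y -> linked X Y -> linked Y Z -> linked X Z.
Proof.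
move=> sY [A [B [DA EB [f f0]]]] [A' [B' [DA' EB' [g g0]]]].
have [r rf] := simple_retract ssC sY f0.
exists (A' ⊗ A), (B ⊗ B'); split; [exact: mon_tens (fs_closed D) _ _ _ _
  | exact: mon_tens (fs_closed E) _ _ _ _ |].
exists (assoc _ B B' ∘ ((associ A' A X ⊗ₘ idm B) ⊗ₘ idm B') ∘
   (associ A' (A ⊗ X) B ⊗ₘ idm B') ∘ (((idm A' ⊗ₘ f) ⊗ₘ idm B') ∘ g)).
apply: iso_comp_neq0.
  apply: is_iso_comp; first apply: is_iso_comp; first exact: assoc_iso.
    apply: is_iso_bf_hom (is_iso_id _).
    exact: is_iso_bf_hom (associ_iso _ _ _) (is_iso_id _).
  exact: is_iso_bf_hom (associ_iso _ _ _) (is_iso_id _).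
by apply: section_comp_neq0 g0; do 2?[apply: bf_hom_retractl
  | apply: bf_hom_retractr]; exact: rf.
Qed.

Lemma linked_sym X Y : simple X -> simple Y -> linked X Y -> linked Y X.
Proof.
move=> sX sY [A [B [DA EB [f f0]]]].
(* Duals are taken inside [D] and [E], so they remain there; the same data are duals in [C]. *)
have [A' [DA' dA]] : exists A', fs_set D A' /\ left_dual A' A.
  have [[A' DA'] dA] := fus_right_dual (fs_fusion D) (exist _ A DA).
  by exists A'; split=> //; exact: dA.
have [B' [EB' dB]] : exists B', fs_set E B' /\ left_dual B B'.
  have [[B' EB'] dB] := fus_left_dual (fs_fusion E) (exist _ B EB).
  by exists B'; split=> //; exact: dB.
(* Transposition moves tensor factors from source to target, so [f] is first replaced by a nonzero
   morphism in the opposite direction. *)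
have [r rf] := simple_retract ssC sY f0.
have r0 : r != 0.
  by apply: (@comp_neq0r _ _ _ _ _ _ f); rewrite rf; apply: simple_id_neq0.
have [g g0] := transpose_r_neq0 dB r0.
have [h h0] := transpose_l_neq0 dA g0.
exists A', B'; split=> //; exists (associ A' Y B' ∘ h).
exact: iso_comp_neq0 (associ_iso _ _ _) h0.
Qed.

(** For the converse, split [A] and [B] into simples of [D] and [E]: some component of [f] is
    nonzero, and it makes [Y] a retract of the corresponding summand. *)
Lemma coset_relP X Y (sX : simple X) (sY : simple Y) :
  coset_rel D E (simple_class sX) (simple_class sY) <-> linked X Y.
Proof.
split=> [[d [e [A [X' [Y' [B [_ _ XX' YY' YF]]]]]]]|].
  have [f f0] := factor_neq0 YF (simple_id_neq0 (iso_simple YY' sY)).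
  apply: (linked_iso (isomorphic_sym XX') (isomorphic_sym YY')).
  exists (sval A), (sval B); split; [exact: svalP A | exact: svalP B |].
  by exists f.
move=> [A [B [DA EB [f f0]]]].
have [n [S [sS [injA [projA [_ _ eA]]]]]] := fusion_subcat_decomp DA.
have [m [T [sT [injB [projB [_ _ eB]]]]]] := fusion_subcat_decomp EB.
have [a fa] : exists a, ((projA a ⊗ₘ idm X) ⊗ₘ idm B) ∘ f != 0.
  apply: (@direct_sum_neq0r _ _ _ _ _ _
    (fun a => (injA a ⊗ₘ idm X) ⊗ₘ idm B)) f0.
  rewrite -[RHS]bf_id -bf_id -eA bf_hom_suml bf_hom_suml.
  by apply: eq_bigr => i _; rewrite -!bf_comp !comp1m.
have [b fb] : exists b, (idm _ ⊗ₘ projB b) ∘ (((projA a ⊗ₘ idm X) ⊗ₘ idm B) ∘ f) != 0.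
  apply: (@direct_sum_neq0r _ _ _ _ _ _ (fun b => idm _ ⊗ₘ injB b)) fa.
  rewrite -[RHS]bf_id -eB bf_hom_sumr.
  by apply: eq_bigr => i _; rewrite -!bf_comp !comp1m.
have [r rf] := simple_retract ssC sY fb.
exists (simple_class (sS a)), (simple_class (sT b)), (S a), X, Y, (T b).
split; try exact: isomorphic_refl.
by apply: retract_factor rf; apply: abelian_split_idempotents; case: ssC.
Qed.

(** By symmetry and transitivity, any member of a double coset can serve as its base point. *)
Lemma double_coset_linked b S T (sS : simple S) (sT : simple T) :
  double_coset D E b -> b (simple_class sS) ->
  b (simple_class sT) <-> linked S T.
Proof.
move=> [x ->] /=; have [X [sX ->]] := Lambda_rep x.
move=> /coset_relP XS; split=> [/coset_relP XT|ST]; last first.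
  by apply/coset_relP; apply: linked_trans XS ST.
by apply: (linked_trans sX) XT; apply: linked_sym.
Qed.

Lemma double_coset_eq b b' x :
  double_coset D E b -> double_coset D E b' -> b x -> b' x -> b = b'.
Proof.
have [X [sX ->]] := Lambda_rep x => db db' bx b'x.
apply/seteqP; split=> y; have [Y [sY ->]] := Lambda_rep y.
  by move/(double_coset_linked sY db bx)/(double_coset_linked sY db' b'x).
by move/(double_coset_linked sY db' b'x)/(double_coset_linked sY db bx).
Qed.

Lemma double_coset_mem (x : Lambda C) :
  double_coset D E [set y | coset_rel D E x y]%classic /\ coset_rel D E x x.
Proof.
split; first by exists x.
by have [X [sX ->]] := Lambda_rep x; apply/coset_relP; apply: linked_refl.
Qed.

Lemma double_cosets_enumerable :
  exists (l : nat) (b : 'I_l -> set (Lambda C)), enumerates_double_cosets D E b.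
Proof.
have [n [S sP]] := fus_finite (fusP C).
(* The finite family [S] meets every simple class but may also contain objects that are not simple,
   hence the option; [undup] below makes the enumeration injective. *)
pose coset i : option (set (Lambda C)) :=
  if pselect (simple (S i)) is left sS
  then Some [set y | coset_rel D E (simple_class sS) y]%classic else None.
pose s := undup (pmap coset (enum 'I_n)).
exists (size s), (fun i => tnth (in_tuple s) i); split.
  by apply/tuple_uniqP; apply: undup_uniq.
move=> b; suff -> : double_coset D E b <-> b \in s.
  by split=> [/(tnthP (in_tuple s))[i ->]|[i <-]]; [exists i | apply: mem_tnth].
rewrite mem_undup mem_pmap; split=> [[x ->]|/mapP[i _]]; last first.
  by rewrite /coset; case: pselect => // sS [->]; eexists.
have [X [sX ->]] := Lambda_rep x; have [i XS] := sP _ sX.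
apply/mapP; exists i; first exact: mem_enum.
rewrite /coset; case: pselect => [sS|]; last by case; apply: iso_simple XS sX.
by rewrite (simple_class_eq sX sS XS).
Qed.

(** * Double coset subcategories as indecomposable bimodules *)

Section Subcategory.
Variable b : set (Lambda C).

(** A nonzero [t] has a nonzero component in some summand, which is isomorphic to [T] by Schur.
    Conversely, the injections of the simple summands of [X] are nonzero. *)
Lemma double_coset_subcatP X : double_coset_subcat b X <->
  forall T (sT : simple T) (t : T ~> X), t != 0 -> b (simple_class sT).
Proof.
split=> [[n [S [bS [inj [proj [_ _ e]]]]]] T sT t t0|bX].
  have [i ti] := direct_sum_neq0r e t0.
  have [x [bx /Lambda_mem[sS ex]]] := bS i.
  have ST := isomorphic_sym (ex_intro _ _ (schur ssC sT sS ti)).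
  suff <- : x = simple_class sT by [].
  by rewrite ex; apply: simple_class_eq.
have [n [S [sS dS]]] := proj2 ssC X; exists n, S; split=> // i.
exists (simple_class (sS i)); split; last exact: isomorphic_refl.
have [inj [proj [pi _ _]]] := dS; apply: (bX _ _ (inj i)).
exact: section_neq0 (pi i) (simple_id_neq0 (sS i)).
Qed.

Lemma double_coset_subcat_retract X Y (s : X ~> Y) (r : Y ~> X) :
  r ∘ s = idm X -> double_coset_subcat b Y -> double_coset_subcat b X.
Proof.
move=> rs /double_coset_subcatP bY; apply/double_coset_subcatP => T sT t t0.
exact: bY (section_comp_neq0 rs t0).
Qed.

Lemma double_coset_subcat_sum n (S : 'I_n -> C) X :
  (forall i, double_coset_subcat b (S i)) -> is_direct_sum S X ->
  double_coset_subcat b X.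
Proof.
move=> bS [inj [proj [_ _ e]]]; apply/double_coset_subcatP => T sT t t0.
have [i ti] := direct_sum_neq0r e t0.
by have /double_coset_subcatP := bS i; apply; exact: ti.
Qed.

Lemma double_coset_subcat_simples X : double_coset_subcat b X ->
  exists n (S : 'I_n -> C), (forall i, simple (S i)) /\ is_direct_sum S X.
Proof. by move=> _; case: ssC. Qed.

Hypothesis db : double_coset D E b.

Lemma double_coset_subcat_tens A X B : fs_set D A -> fs_set E B ->
  double_coset_subcat b X -> double_coset_subcat b (A ⊗ X ⊗ B).
Proof.
move=> DA EB [n [S [bS [inj [proj [_ _ e]]]]]].
apply/double_coset_subcatP => T sT t t0.
have [i ti] : exists i, ((idm A ⊗ₘ proj i) ⊗ₘ idm B) ∘ t != 0.
  apply: (@direct_sum_neq0r _ _ _ _ _ _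
    (fun i => (idm A ⊗ₘ inj i) ⊗ₘ idm B)) t0.
  rewrite -[RHS]bf_id -bf_id -e bf_hom_sumr bf_hom_suml.
  by apply: eq_bigr => i _; rewrite -!bf_comp !comp1m.
have [x [bx /Lambda_mem[sS ex]]] := bS i; rewrite ex in bx.
by apply/(double_coset_linked sT db bx); exists A, B; split=> //; eexists; apply: ti.
Qed.

Lemma double_coset_sub_bimodule :
  sub_bimodule (double_coset_subcat b : set (regular_bimod D E)).
Proof.
split.
- by move=> X Y [f [g [_ fg]]]; apply: (double_coset_subcat_retract fg).
- exact: (full_subcat_semisimple ssC double_coset_subcat_retract
    double_coset_subcat_sum double_coset_subcat_simples).
(* Each one-sided action reduces to the two-sided one by inserting the unit on the other side. *)
- move=> A X bX; have [r rK] := runit_iso (sval A ⊗ X).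
  apply: (double_coset_subcat_retract (proj2 rK)).
  exact: double_coset_subcat_tens (svalP A) (mon_unit (fs_closed E)) bX.
move=> X B bX; have [l lK] := lunit_iso X.
apply: (double_coset_subcat_retract (bf_hom_retractl tens _ (proj2 lK))).
exact: double_coset_subcat_tens (mon_unit (fs_closed D)) (svalP B) bX.
Qed.

Lemma double_coset_indecomposable
    (h : sub_bimodule (double_coset_subcat b : set (regular_bimod D E))) :
  indecomposable (sub_bimod h).
Proof.
move=> [N [subN ntN [_ orthN]]].
(* [S] is a simple retract in [C] of an object of [N i]; whether [S] itself lies in [N i] does not
   matter. *)
have simple_part i : exists (X : sub_bimod h) S (sS : simple S)
    (s : S ~> sval X) (r : sval X ~> S),
    [/\ N i X, b (simple_class sS) & r ∘ s = idm S].
  have [X [NX X0]] := ntN i.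
  have X1 : idm (sval X) != 0.
    by apply/eqP => e; apply: X0; apply/zero_objectP.
  have [n [S [sS [inj [proj [pi _ e]]]]]] := proj2 ssC (sval X).
  have [j jX] := direct_sum_neq0r e X1.
  exists X, (S j), (sS j), (inj j), (proj j); split=> //.
  apply: ((double_coset_subcatP _).1 (svalP X) _ _ (inj j)).
  exact: section_neq0 (pi j) (simple_id_neq0 (sS j)).
have [X [S [sS [s [r [NX bS rs]]]]]] := simple_part ord0.
have [Y [T [sT [u [v [NY bT vu]]]]]] := simple_part ord_max.
have [A [B [DA EB [f f0]]]] := (double_coset_linked sT db bS).1 bT.
have [g gf] := simple_retract ssC sT f0.
pose A' : D := exist _ A DA; pose B' : E := exist _ B EB.
have NAXB := sb_ract (subN ord0) B' (sb_lact (subN ord0) A' NX).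
have /eqP := orthN ord0 ord_max isT _ _ NAXB NY
  (u ∘ (g ∘ ((idm A ⊗ₘ r) ⊗ₘ idm B))).
(* As [u] is a section and the tensored [r] a retraction, it remains to see that [g] is nonzero,
   which follows from [g ∘ f = idm T]. *)
apply/negP; apply: section_comp_neq0 vu _.
apply: comp_retraction_neq0.
  exact: bf_hom_retractl (bf_hom_retractr _ _ rs).
by apply: (@comp_neq0r _ _ _ _ _ _ f); rewrite gf; apply: simple_id_neq0.
Qed.

End Subcategory.

(** The simple summands of [X] are grouped by double coset: the partial sums [p i] of the projectors
    are orthogonal idempotents with sum [idm X], and splitting them gives the components. A nonzero
    morphism between two parts would put a simple class in both cosets. *)
Lemma double_coset_decomposition l (B : 'I_l -> set (Lambda C)) :
  enumerates_double_cosets D E B ->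
  direct_sum_decomposition
    (fun i => double_coset_subcat (B i) : set (regular_bimod D E)).
Proof.
move=> [injB BP]; have dB i : double_coset D E (B i) by apply/BP; exists i.
split=> [X|i j ij X Y [n [S [BS [inj [proj [_ _ e]]]]]] BY f]; last first.
  apply/eqP; apply: contraNT ij => f0.
  have [a fa] := direct_sum_neq0l e f0.
  have [x [Bx /Lambda_mem[sS ex]]] := BS a; rewrite ex in Bx.
  apply/eqP/injB; apply: double_coset_eq (dB i) (dB j) Bx _.
  by have /double_coset_subcatP := BY; apply; exact: fa.
have [n [S [sS [inj [proj [pi pij e]]]]]] := proj2 ssC X.
have /choice[c cP] a : exists i, B i (simple_class (sS a)).
  have [db bx] := double_coset_mem (simple_class (sS a)).
  by have [i ei] := (BP _).1 db; exists i; rewrite ei.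
pose p i := \sum_(a | c a == i) inj a ∘ proj a.
have inj_proj a a' : a != a' -> inj a ∘ proj a ∘ (inj a' ∘ proj a') = 0.
  by move=> aa'; rewrite compmA -(compmA (inj a)) pij // compm0 comp0m.
have pp i : p i ∘ p i = p i.
  rewrite {1}/p compm_suml; apply: eq_bigr => a /eqP ca.
  rewrite compm_sumr (bigD1 a) ?ca //= big1 ?addr0; last first.
    by move=> a' /andP[_ aa']; apply: inj_proj; rewrite eq_sym.
  by rewrite compmA -(compmA (inj a)) pi compm1.
have pp0 i j : i != j -> p i ∘ p j = 0.
  move=> ij; rewrite compm_suml big1 // => a /eqP ca.
  rewrite compm_sumr big1 // => a' /eqP ca'; apply: inj_proj.
  by apply: contraNneq ij => aa'; rewrite -ca -ca' aa'.
have splits : split_idempotents C by apply: abelian_split_idempotents; case: ssC.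
(* The object and its two splitting maps are packed together so that one use of [choice] selects all
   three. *)
have /choice[Z ZP] i : exists Z : {Y : C & ((Y ~> X) * (X ~> Y))%type},
    (projT2 Z).2 ∘ (projT2 Z).1 = idm _ /\ (projT2 Z).1 ∘ (projT2 Z).2 = p i.
  by have [Y [s [r sr]]] := splits X (p i) (pp i); exists (existT _ Y (s, r)).
pose Y i := projT1 (Z i); pose s i : Y i ~> X := (projT2 (Z i)).1.
pose r i : X ~> Y i := (projT2 (Z i)).2.
have rs i : r i ∘ s i = idm (Y i) by case: (ZP i).
have sr i : s i ∘ r i = p i by case: (ZP i).
exists Y; split=> [i|]; last first.
  exists s, r; split=> // [i j ij|].
    (* Here [r i ∘ s j = r i ∘ p i ∘ p j ∘ s j], which vanishes by orthogonality. *)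
    rewrite -(compm1 (s j)) -rs (compmA (s j)) sr -(comp1m (r i)) -rs.
    by rewrite -(compmA (r i)) sr -!compmA (compmA (p i)) pp0 // comp0m compm0.
  rewrite -e (partition_big c xpredT) //=.
  by apply: eq_bigr => i _; rewrite sr.
apply/double_coset_subcatP => T sT t t0.
(* A simple [T] mapping nontrivially to [Y i] thus has a nonzero morphism to some [S a] with
   [c a = i]. *)
have : p i ∘ (s i ∘ t) != 0.
  by rewrite -sr -compmA (compmA (r i)) rs comp1m; apply: section_comp_neq0 (rs i) t0.
rewrite compm_suml => /sum_neq0[a /eqP ca].
rewrite -compmA => /comp_neq0l ta.
suff <- : simple_class (sS a) = simple_class sT by rewrite -ca.
apply/simple_class_eq/isomorphic_sym.
by exists (proj a ∘ (s i ∘ t)); apply: schur ta.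
Qed.

End DoubleCosets.

(** The existence of a finite enumeration keeps the second conjunct, stated for every enumeration,
    from being vacuous. *)
Theorem proposition2p4 (k : fieldType) (C : fusion_cat k)
    (D E : fusion_subcat C) :
  (exists (l : nat) (B : 'I_l -> set (Lambda C)),
      enumerates_double_cosets D E B) /\
  (forall (l : nat) (B : 'I_l -> set (Lambda C)),
      enumerates_double_cosets D E B ->
      let M := regular_bimod D E in
      let N := fun i : 'I_l => double_coset_subcat (B i) : set M in
      exists h : forall i : 'I_l, sub_bimodule (N i),
        (forall i : 'I_l, indecomposable (sub_bimod (h i))) /\
        direct_sum_decomposition N).
Proof.
split; first exact: double_cosets_enumerable.
move=> l B BE M N; have dB i : double_coset D E (B i) by apply/(proj2 BE); exists i.
exists (fun i => double_coset_sub_bimodule (dB i)); split=> [i|].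
  exact: double_coset_indecomposable (dB i) _.
exact: double_coset_decomposition BE.
Qed.
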